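(* Let $F$ be a multigraph and let $k\geq 2$ be an even integer. Then $\mathrm{ex}(n,F^{k-1})=O(n^{1+\frac{1}{k}})$, where the implied constant may depend on $F$ and $k$ but not on $n$.
   Context: For a multigraph $F$ and an integer $m\geq 0$, the $m$-subdivision $F^{m}$ of $F$ is the graph obtained by replacing the edges of $F$ with pairwise internally vertex-disjoint paths of length $m+1$. For a graph $F'$, $\mathrm{ex}(n,F')$ denotes the maximum number of edges in an $n$-vertex graph not containing $F'$ as a subgraph. *)

(* Defs.v *)
From mathcomp Require Import all_boot.

Set Implicit Arguments.
Unset Strict Implicit.
Unset Printing Implicit Defensive.

(* Finite loopless multigraphs; parallel edges are distinct elements of [edge].
   The orientation given by [src] and [tgt] is an arbitrary one, used only to
   parametrize the subdivided edges. *)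
Record multigraph := Multigraph {
  vert : finType;
  edge : finType;
  src : edge -> vert;
  tgt : edge -> vert;
  loopless : forall e, src e != tgt e
}.

(* A simple graph on the vertex set T is given by its set of edges, each of
   which is a two-element subset of T. *)
Definition is_graph (T : finType) (G : {set {set T}}) : bool :=
  [forall A in G, #|A| == 2].

(* Not necessarily induced subgraphs, up to isomorphism. *)
Definition contains (S T : finType) (G : {set {set T}}) (H : {set {set S}}) :
    bool :=
  [exists f : {ffun S -> T}, injectiveb f && [forall A in H, f @: A \in G]].

(* The maximum of the empty family is 0. *)
Definition extremal_number (n : nat) (S : finType) (H : {set {set S}}) : nat :=
  \max_(G : {set {set 'I_n}} | is_graph G && ~~ contains G H) #|G|.

Section Subdivision.
Variables (F : multigraph) (m : nat).

Definition subdiv_vert : finType := (vert F + edge F * 'I_m)%type.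

(* The path replacing e is src e = path_vert e 0, path_vert e 1, ...,
   path_vert e m.+1 = tgt e; its m internal vertices are the inr (e, j). *)
Definition path_vert (e : edge F) (i : nat) : subdiv_vert :=
  if i is j.+1 then
    if insub j is Some j' then inr (e, j') else inl (tgt e)
  else inl (src e).

(* For m = 0 this is the underlying simple graph of F. *)
Definition subdivision : {set {set subdiv_vert}} :=
  [set [set path_vert e i; path_vert e i.+1] | e : edge F, i : 'I_m.+1].

Lemma subdivision_is_graph : is_graph subdivision.
Proof.
apply/forall_inP => _ /imset2P[e i _ _ ->]; rewrite cards2 /path_vert.
case: i => [[|j] ltj] /=.
  case: insubP => [u _ _ //|_].
  by rewrite (inj_eq inl_inj) loopless.
rewrite insubT //=; case: insubP => [u _ vu|//].
by rewrite (inj_eq inr_inj) xpair_eqE eqxx -val_eqE vu /= neq_ltn ltnSn.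
Qed.

End Subdivision.

(* Main.v *)
(* Delete vertices until the minimum degree is d, with d ^ k >= C n, and
   consider random walks weighted by the symmetric normalized adjacency matrix
   B x y = [x ~ y] / sqrt (deg x * deg y).  The closed walks of length 2k in
   which two positions coincide have total weight at most a constant times
   sum_u b_l(u) b_(2k - l)(u) with 0 < l < 2k and b_m(u) = (B ^ m) u u.
   Log-convexity of m |-> b_(2m)(u) makes l = 2 the worst case, and
   b_2(u) <= 1 / d, so this is at most tr (B ^ (2k - 2)) / d.  As
   tr (B ^ 2k) >= 1, log-convexity of the traces shows that this is a small
   proportion of tr (B ^ 2k).

   Hence for most pairs (x, x'), weighted by (B ^ k) x x' squared, almost all
   pairs of k-walks from x to x' are internally disjoint paths, so that x and
   x' are joined by arbitrarily many internally disjoint k-paths.  For k = 2h,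
   the square ((B ^ k) x x')^2 is the sum over (v, z) of mu x * mu x', where
   mu x = (B ^ h) v x * (B ^ h) x z.  For some (v, z), points drawn
   independently with law mu are thus pairwise joined in this way with positive
   probability; they serve as branch vertices, and the paths are chosen
   greedily. *)
Require Import Defs.
From HB Require Import structures.
From mathcomp Require Import all_boot all_order all_algebra.
From mathcomp Require Import ring lra zify.
Import Order.TTheory GRing.Theory Num.Theory.
Local Open Scope ring_scope.

(** * Cauchy-Schwarz and log-convex sequences *)

Lemma cauchy_schwarz_sum {R : realFieldType} {I : finType} (a b : I -> R) :
  (\sum_i a i * b i) ^+ 2 <= (\sum_i a i ^+ 2) * (\sum_i b i ^+ 2).
Proof.
have : 0 <= \sum_i \sum_j (a i * b j - a j * b i) ^+ 2.
  by apply: sumr_ge0 => i _; apply: sumr_ge0 => j _; apply: sqr_ge0.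
have -> : \sum_i \sum_j (a i * b j - a j * b i) ^+ 2 =
   (\sum_i a i ^+ 2) * (\sum_i b i ^+ 2) *+ 2 - (\sum_i a i * b i) ^+ 2 *+ 2.
  rewrite expr2 !mulr2n {2}[(\sum_i a i ^+ 2) * _]mulrC !big_distrlr /=.
  rewrite -!big_split -sumrB; apply: eq_bigr => i _.
  by rewrite -!big_split -sumrB; apply: eq_bigr => j _ /=; ring.
lra.
Qed.

Section LogConvex.
Context {R : realFieldType} {p : nat -> R}.
Hypothesis p_ge0 : forall j, 0 <= p j.
Hypothesis p_cvx : forall j, p j.+1 ^+ 2 <= p j * p j.+2.

(** The ratios [p j.+1 / p j] are nondecreasing; the division-free induction treats a vanishing term
    separately. *)
Lemma logconvex_step j d : p j.+1 * p (j + d).+1 <= p j * p (j + d).+2.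
Proof.
elim: d => [|d IH]; first by rewrite addn0 -expr2.
have [pm0|pm_neq0] := eqVneq (p (j + d).+1) 0.
  have := p_cvx (j + d).+1; rewrite pm0 mul0r => h.
  have : p (j + d).+2 ^+ 2 == 0 by rewrite eq_le h sqr_ge0.
  by rewrite sqrf_eq0 addnS => /eqP ->; rewrite mulr0 mulr_ge0.
have pm_gt0 : 0 < p (j + d).+1 by rewrite lt_def pm_neq0 p_ge0.
rewrite addnS -(ler_pM2l pm_gt0).
have h1 := ler_wpM2r (p_ge0 (j + d).+2) IH.
have h2 := ler_wpM2l (p_ge0 j) (p_cvx (j + d).+1).
rewrite expr2 in h2; lra.
Qed.

(** Each induction step moves both indices outwards by one, so their gap grows by 2: hence [d.+2] in
    the recursive call. *)
Lemma logconvex_spread i j d :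
  p (i + j) * p (i + j + d) <= p i * p (i + j + d + j).
Proof.
elim: j d => [|j IH] d; first by rewrite !addn0.
have -> : (i + j.+1 + d + j.+1 = i + j + d.+2 + j)%N by lia.
apply: le_trans (IH d.+2).
by rewrite !addnS !addSn; apply: logconvex_step.
Qed.

(** On a logarithmic scale, the point at [j] lies below the chord from [0] to [j.+1]. *)
Lemma logconvex_pow j : p j ^+ j.+1 <= p 0%N * p j.+1 ^+ j.
Proof.
elim: j => [|j IH]; first by rewrite expr1 expr0 mulr1.
have [pj0|pj_neq0] := eqVneq (p j.+1) 0.
  by rewrite pj0 expr0n /= mulr_ge0 // exprn_ge0.
have pj_gt0 : 0 < p j.+1 ^+ j by rewrite exprn_gt0 // lt_def pj_neq0 p_ge0.
rewrite -(ler_pM2l pj_gt0) -exprD.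
have -> : (j + j.+2 = 2 * j.+1)%N by lia.
rewrite exprM (le_trans (lerXn2r j.+1 _ _ (p_cvx j))) ?nnegrE ?sqr_ge0 //.
  by rewrite mulr_ge0.
by rewrite exprMn mulrA [_ * p 0%N]mulrC ler_wpM2r // exprn_ge0.
Qed.

End LogConvex.

(** Log-convexity is available along even indices. An odd [l] is bounded through its two even
    neighbours, and [b 1 = 0] disposes of the ends [1] and [2k - 1], where a neighbour leaves the
    range. *)
Lemma logconvex_middle {R : realFieldType} {b : nat -> R} (k l : nat) :
  (forall m, 0 <= b m) ->
  (forall i j, b (i + j)%N ^+ 2 <= b (i + i)%N * b (j + j)%N) ->
  b 1%N = 0 -> (0 < l < k + k)%N ->
  b l * b (k + k - l)%N <= b 2%N * b (k.-1 + k.-1)%N.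
Proof.
move=> b_ge0 b_cvx b1 /andP[l_gt0 lt_l].
pose p j := b (j + j)%N.
have p_ge0 j : 0 <= p j by exact: b_ge0.
have p_cvx j : p j.+1 ^+ 2 <= p j * p j.+2.
  by have := b_cvx j j.+2; rewrite /p addSn !addnS.
have even_case j : (0 < j < k)%N -> p j * p (k - j)%N <= p 1%N * p k.-1.
  wlog: j / (j <= k - j)%N => [hw|le_j] /andP[j_gt0 lt_j].
    case: (leqP j (k - j)) => [/hw|lt_kj]; first by apply; rewrite j_gt0.
    have {1}-> : j = (k - (k - j))%N by lia.
    by rewrite mulrC; apply: hw; lia.
  have := logconvex_spread p_ge0 p_cvx 1 j.-1 (k - j - j).
  have -> : (1 + j.-1 = j)%N by lia.
  have -> : (j + (k - j - j) = k - j)%N by lia.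
  by have -> : (k - j + j.-1 = k.-1)%N by lia.
have [odd_l|even_l] := boolP (odd l); last first.
  have el : (l = l./2 + l./2)%N by rewrite addnn even_halfK.
  have -> : (k + k - l = (k - l./2) + (k - l./2))%N by lia.
  by rewrite {1}el; apply: even_case; lia.
have [l1|l_neq1] := eqVneq l 1%N; first by rewrite l1 b1 mul0r mulr_ge0.
have [l1|l_neq2k] := eqVneq (k + k - l)%N 1%N.
  by rewrite l1 b1 mulr0 mulr_ge0.
pose j := l./2.
have el : (l = j + j.+1)%N by rewrite addnS addnn -{1}(odd_double_half l) odd_l.
have h1 := b_cvx j j.+1.
have h2 := b_cvx (k - j.+1)%N (k - j)%N.
have -> : (k + k - l = k - j.+1 + (k - j))%N by lia.
rewrite el -(@ler_pXn2r _ 2) ?nnegrE ?mulr_ge0 // exprMn.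
apply: le_trans (ler_pM (sqr_ge0 _) (sqr_ge0 _) h1 h2) _.
(* Regrouping pairs [p j] with [p (k - j)] and [p j.+1] with [p (k - j.+1)]; the even case bounds
   each pair. *)
rewrite mulrACA [X in X * _]mulrC mulrAC mulrA.
have := ler_pM _ _ (even_case j _) (even_case j.+1 _).
rewrite !mulr_ge0 // => /(_ isT isT).
have -> : (0 < j < k)%N by lia.
have -> : (0 < j.+1 < k)%N by lia.
move=> /(_ isT isT); rewrite -expr2; apply: le_trans; rewrite le_eqVlt.
by apply/orP; left; apply/eqP; rewrite /p; ring.
Qed.

(** * Random selection under pairwise constraints *)

Section RandomSelection.
Context {R : realFieldType} {I T : finType} {mu : T -> R}.

(** Independence of two coordinates under a product law; multiplying by the masses avoids dividing
    by a total mass that may vanish. *)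
Lemma sum_ffun_pinned2 (i j : I) (x y : T) : i != j ->
  (\sum_z mu z) ^+ 2 *
    (\sum_(g : {ffun I -> T} | (g i == x) && (g j == y)) \prod_l mu (g l)) =
  (\sum_z mu z) ^+ #|I| * (mu x * mu y).
Proof.
(* The two constraints become 0/1 factors at the coordinates [i] and [j], so that the sum over [g]
   factors. *)
move=> neq_ij; pose F l z := mu z * ((l == i) ==> (z == x))%:R
                                  * ((l == j) ==> (z == y))%:R.
have -> : \sum_(g : {ffun I -> T} | (g i == x) && (g j == y)) \prod_l mu (g l)
    = \prod_l \sum_z F l z.
  rewrite bigA_distr_bigA big_mkcond; apply: eq_bigr => g _ /=.
  case: ifPn => [/andP[gi gj]|].
    apply: eq_bigr => l _; rewrite /F.
    have -> : (l == i) ==> (g l == x) by apply/implyP => /eqP ->.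
    have -> : (l == j) ==> (g l == y) by apply/implyP => /eqP ->.
    by rewrite !mulr1.
  rewrite negb_and => /orP[] /negPf h.
    by rewrite (bigD1 i) //= /F eqxx h /= mulr0 !mul0r.
  by rewrite (bigD1 j) //= /F eqxx h /= mulr0 mul0r.
have neq_ji : j != i by rewrite eq_sym.
have Fi : \sum_z F i z = mu x.
  rewrite (bigD1 x) //= big1 => [|z /negPf h]; last first.
    by rewrite /F eqxx h mulr0 mul0r.
  by rewrite /F !eqxx (negPf neq_ij) /= !mulr1 addr0.
have Fj : \sum_z F j z = mu y.
  rewrite (bigD1 y) //= big1 => [|z /negPf h]; last first.
    by rewrite /F eqxx h mulr0.
  by rewrite /F !eqxx (negPf neq_ji) /= !mulr1 addr0.
rewrite -prodr_const [in RHS](bigD1 i) //= [in RHS](bigD1 j) //=.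
rewrite (bigD1 i) //= (bigD1 j) //= Fi Fj.
have -> : \prod_(l | (l != i) && (l != j)) \sum_z F l z =
    \prod_(l | (l != i) && (l != j)) \sum_z mu z.
  apply: eq_bigr => l /andP[/negPf li /negPf lj]; apply: eq_bigr => z _.
  by rewrite /F li lj !mulr1.
by ring.
Qed.

(* A random map [I -> T] with independent values of law [mu] works: the union
   bound over the pairs of indices leaves a positive probability. *)
Lemma random_selection (bad : rel T) : (forall x, 0 <= mu x) ->
  #|I|%:R ^+ 2 * (\sum_x \sum_y (bad x y)%:R * (mu x * mu y))
    < (\sum_x mu x) ^+ 2 ->
  exists g : I -> T, (forall i, 0 < mu (g i)) /\
    (forall i j, i != j -> ~~ bad (g i) (g j)).
Proof.
move=> mu_ge0 lt_bad.
set M := \sum_x mu x in lt_bad *; set B := \sum_x _ in lt_bad.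
have M_ge0 : 0 <= M by apply: sumr_ge0.
have B_ge0 : 0 <= B.
  by apply: sumr_ge0 => x _; apply: sumr_ge0 => y _; rewrite !mulr_ge0.
have M_gt0 : 0 < M.
  rewrite lt_def M_ge0 andbT; apply/negP => /eqP M0.
  by move: lt_bad; rewrite M0 expr0n /= ltNge mulr_ge0 ?sqr_ge0.
pose P (g : {ffun I -> T}) := \prod_l mu (g l).
have P_ge0 g : 0 <= P g by apply: prodr_ge0.
pose good (g : {ffun I -> T}) :=
  [forall i, forall j, (i != j) ==> ~~ bad (g i) (g j)].
have sumP : \sum_g P g = M ^+ #|I|.
  by rewrite -prodr_const bigA_distr_bigA.
(* Each pair of distinct indices is bad with probability [B / M ^ 2]. *)
have pair_bound i j : i != j ->
    M ^+ 2 * (\sum_(g : {ffun I -> T} | bad (g i) (g j)) P g) = M ^+ #|I| * B.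
  move=> neq_ij.
  rewrite (partition_big (fun g : {ffun I -> T} => (g i, g j)) xpredT) //=.
  rewrite /B pair_big /= !mulr_sumr; apply: eq_bigr => -[x y] _ /=.
  rewrite mulrCA -(sum_ffun_pinned2 i j x y neq_ij) mulrCA; congr (_ * _).
  rewrite mulr_sumr big_mkcond [RHS]big_mkcond; apply: eq_bigr => g _.
  rewrite xpair_eqE; case: eqP => [->|]; last by rewrite andbF.
  case: eqP => [->|]; last by rewrite !andbF.
  by case: (bad x y); rewrite ?mul1r ?mul0r.
have bad_bound : M ^+ 2 * (\sum_(g | ~~ good g) P g)
    <= #|I|%:R ^+ 2 * (M ^+ #|I| * B).
  have : M ^+ 2 * (\sum_(g | ~~ good g) P g) <=
      M ^+ 2 * \sum_(g : {ffun I -> T}) \sum_i \sum_(j | i != j)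
        (bad (g i) (g j))%:R * P g.
    apply: ler_wpM2l; first exact: sqr_ge0.
    rewrite big_mkcond; apply: ler_sum => g _; case: ifPn => [|_]; last first.
      by apply: sumr_ge0 => i _; apply: sumr_ge0 => j _; rewrite mulr_ge0.
    rewrite negb_forall => /existsP[i]; rewrite negb_forall => /existsP[j].
    rewrite negb_imply negbK => /andP[neq_ij bad_ij].
    rewrite (bigD1 i) //= (bigD1 j) //= bad_ij mul1r -addrA lerDl.
    apply: addr_ge0; first by apply: sumr_ge0 => ? _; rewrite mulr_ge0.
    by apply: sumr_ge0 => ? _; apply: sumr_ge0 => ? _; rewrite mulr_ge0.
  move=> /le_trans; apply.
  rewrite exchange_big mulr_sumr /= expr2 -mulrA mulr_natl -sumr_const.
  apply: ler_sum => i _; rewrite exchange_big mulr_sumr /= mulr_natl.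
  rewrite -sumr_const [X in _ <= X](bigID (fun j => i != j)) /=.
  rewrite -[X in X <= _]addr0; apply: lerD; last first.
    by apply: sumr_ge0 => *; rewrite mulr_ge0 ?exprn_ge0.
  apply: ler_sum => j neq_ij; rewrite -(pair_bound i j neq_ij).
  rewrite [X in _ <= _ * X]big_mkcond /=.
  apply: ler_wpM2l; first exact: sqr_ge0.
  by apply: ler_sum => g _; case: (bad _ _); rewrite ?mul1r ?mul0r.
have good_gt0 : 0 < \sum_(g | good g) P g.
  have : M ^+ 2 * (\sum_(g | ~~ good g) P g) < M ^+ 2 * M ^+ #|I|.
    apply: le_lt_trans bad_bound _.
    by rewrite mulrCA mulrC ltr_pM2r // exprn_gt0.
  rewrite ltr_pM2l ?exprn_gt0 // -sumP [X in _ < X](bigID good) /=.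
  by rewrite ltrDr.
have [g good_g Pg_gt0] : exists2 g, good g & 0 < P g.
  apply/exists_inP; apply: contraLR good_gt0.
  rewrite negb_exists_in => /forall_inP h.
  by rewrite -leNgt; apply: sumr_le0 => g /h; rewrite -leNgt.
exists g; split=> [i|i j neq_ij]; last first.
  by move/forallP: good_g => /(_ i)/forallP/(_ j)/implyP; apply.
rewrite lt_def mu_ge0 andbT; apply: contraTneq Pg_gt0 => mu0.
by rewrite /P (bigD1 i) //= mu0 mul0r ltxx.
Qed.

End RandomSelection.

(** * Weighted walks *)

Section WeightedWalks.
Context {R : realFieldType} {T : finType} (w : T -> T -> R).

Fixpoint walk_weight (x : T) (s : seq T) : R :=
  if s is y :: s' then w x y * walk_weight y s' else 1.

(** The entry [(x, y)] of the [m]-th power of the matrix [w]; a walk is the list of its vertices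
    after the start [x]. *)
Definition walk_sum (m : nat) (x y : T) : R :=
  \sum_(s : m.-tuple T | last x s == y) walk_weight x s.

Lemma walk_weight_cat x s1 s2 :
  walk_weight x (s1 ++ s2) = walk_weight x s1 * walk_weight (last x s1) s2.
Proof. by elim: s1 x => [|y s IH] x /=; rewrite ?mul1r // IH mulrA. Qed.

Lemma sum_tuple_cat a b (F : seq T -> R) :
  \sum_(s : (a + b).-tuple T) F s =
    \sum_(s1 : a.-tuple T) \sum_(s2 : b.-tuple T) F (s1 ++ s2).
Proof.
rewrite pair_big /=.
rewrite (reindex (fun p : a.-tuple T * b.-tuple T => cat_tuple p.1 p.2)) //=.
have st (s : (a + b).-tuple T) : size (take a s) == a.
  by rewrite size_takel // size_tuple leq_addr.
have sd (s : (a + b).-tuple T) : size (drop a s) == b.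
  by rewrite size_drop size_tuple addKn.
exists (fun s : (a + b).-tuple T => (Tuple (st s), Tuple (sd s))).
  move=> [s1 s2] _; congr (_, _); apply: val_inj => /=.
    by rewrite take_size_cat // size_tuple.
  by rewrite drop_size_cat // size_tuple.
by move=> s _; apply: val_inj; rewrite /= cat_take_drop.
Qed.

Lemma sum_walk_last a x (F : T -> R) :
  \sum_(s : a.-tuple T) walk_weight x s * F (last x s) =
  \sum_v walk_sum a x v * F v.
Proof.
rewrite (partition_big (fun s : a.-tuple T => last x s) xpredT) //=.
apply: eq_bigr => v _; rewrite /walk_sum mulr_suml.
by apply: eq_bigr => s /eqP ->.
Qed.

Lemma walk_sumE m x y :
  walk_sum m x y = \sum_(s : m.-tuple T) walk_weight x s * (last x s == y)%:R.
Proof.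
rewrite /walk_sum big_mkcond; apply: eq_bigr => s _.
by case: eqP; rewrite ?mulr1 ?mulr0.
Qed.

Lemma walk_sum0 x y : walk_sum 0 x y = (x == y)%:R.
Proof.
rewrite walk_sumE (bigD1 [tuple]) //= mul1r big1 ?addr0 // => s /eqP[].
exact: tuple0.
Qed.

Lemma walk_sum1 x y : walk_sum 1 x y = w x y.
Proof.
rewrite walk_sumE (reindex (fun z : T => [tuple z])) /=; last first.
  exists (fun s : 1.-tuple T => thead s) => [z _|s _]; first by rewrite theadE.
  by rewrite [RHS]tuple_eta; apply: val_inj => /=; case: s => -[|? []].
rewrite (bigD1 y) //= eqxx !mulr1 big1 ?addr0 // => z /negPf ->.
by rewrite mulr0.
Qed.

Lemma sum_walk_via a b x y (F : T -> R) :
  \sum_(s : (a + b).-tuple T)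
     walk_weight x s * ((last x s == y)%:R * F (last x (take a s))) =
  \sum_u walk_sum a x u * (F u * walk_sum b u y).
Proof.
rewrite (sum_tuple_cat a b (fun s =>
  walk_weight x s * ((last x s == y)%:R * F (last x (take a s))))).
rewrite -(sum_walk_last a x (fun u => F u * walk_sum b u y)).
apply: eq_bigr => s1 _; rewrite walk_sumE !mulr_sumr; apply: eq_bigr => s2 _.
by rewrite walk_weight_cat last_cat take_size_cat ?size_tuple //; ring.
Qed.

Lemma walk_sumD a b x y :
  walk_sum (a + b) x y = \sum_u walk_sum a x u * walk_sum b u y.
Proof.
transitivity (\sum_u walk_sum a x u * (1 * walk_sum b u y)).
  rewrite walk_sumE -(sum_walk_via a b x y (fun=> 1)).
  by apply: eq_bigr => s _; rewrite mulr1.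
by apply: eq_bigr => u _; rewrite mul1r.
Qed.

Lemma sum_walk_pinned a b x y u :
  \sum_(s : (a + b).-tuple T | last x s == y)
     walk_weight x s * (last x (take a s) == u)%:R  =
  walk_sum a x u * walk_sum b u y.
Proof.
transitivity (\sum_v walk_sum a x v * ((v == u)%:R * walk_sum b v y)).
  rewrite -(sum_walk_via a b x y (fun v => (v == u)%:R)) big_mkcond.
  by apply: eq_bigr => s _; case: eqP; rewrite ?mul1r ?mul0r ?mulr0.
rewrite (bigD1 u) //= eqxx mul1r big1 ?addr0 // => v /negPf ->.
by rewrite mul0r mulr0.
Qed.

Lemma sum_walk_return a l b x y :
  \sum_(s : (a + (l + b)).-tuple T | last x s == y)
     walk_weight x s * (last x (take a s) == last x (take (a + l) s))%:R =
  \sum_u walk_sum a x u * (walk_sum l u u * walk_sum b u y).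
Proof.
rewrite big_mkcond /=.
transitivity (\sum_(s : (a + (l + b)).-tuple T) walk_weight x s *
   ((last x s == y)%:R * (last x (take a s) == last x (take (a + l) s))%:R)).
  by apply: eq_bigr => s _; case: eqP; rewrite ?mul1r ?mul0r ?mulr0.
rewrite (sum_tuple_cat a (l + b) (fun s => walk_weight x s *
   ((last x s == y)%:R * (last x (take a s) == last x (take (a + l) s))%:R))).
rewrite -(sum_walk_last a x (fun u => walk_sum l u u * walk_sum b u y)).
apply: eq_bigr => s1 _.
rewrite -(sum_walk_pinned l b) mulr_sumr [RHS]big_mkcond.
apply: eq_bigr => s2 _.
rewrite walk_weight_cat last_cat take_size_cat ?size_tuple //.
rewrite takeD take_size_cat ?drop_size_cat ?size_tuple // last_cat.
rewrite [last x s1 == _]eq_sym.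
by case: eqP; rewrite ?mul1r ?mul0r ?mulr0 ?mulrA.
Qed.

(** * Symmetric nonnegative weights and log-convexity *)

Hypothesis w_sym : forall x y, w x y = w y x.
Hypothesis w_ge0 : forall x y, 0 <= w x y.

Lemma walk_weight_ge0 x s : 0 <= walk_weight x s.
Proof. by elim: s x => [|y s IH] x //=; rewrite mulr_ge0. Qed.

Lemma walk_sum_ge0 m x y : 0 <= walk_sum m x y.
Proof. by apply: sumr_ge0 => s _; apply: walk_weight_ge0. Qed.

Lemma walk_sum_sym m x y : walk_sum m x y = walk_sum m y x.
Proof.
elim: m x y => [|m IH] x y; first by rewrite !walk_sum0 eq_sym.
rewrite -[in LHS]add1n -[in RHS]addn1 !walk_sumD; apply: eq_bigr => u _.
by rewrite !walk_sum1 w_sym IH mulrC.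
Qed.

(** By symmetry, a diagonal entry of the power [a + b] is the inner product of the rows [u] of the
    powers [a] and [b]. *)
Lemma walk_sum_cvx i j u :
  walk_sum (i + j) u u ^+ 2 <= walk_sum (i + i) u u * walk_sum (j + j) u u.
Proof.
have E a b : walk_sum (a + b) u u = \sum_v walk_sum a u v * walk_sum b u v.
  by rewrite walk_sumD; apply: eq_bigr => v _; rewrite (walk_sum_sym b).
by rewrite !E; apply: cauchy_schwarz_sum.
Qed.

Lemma walk_trace i j :
  \sum_u walk_sum (i + j) u u = \sum_p walk_sum i p.1 p.2 * walk_sum j p.1 p.2.
Proof.
rewrite -(pair_big xpredT xpredT
  (fun u v => walk_sum i u v * walk_sum j u v)) /=.
apply: eq_bigr => u _; rewrite walk_sumD; apply: eq_bigr => v _.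
by rewrite (walk_sum_sym j).
Qed.

Lemma walk_trace_cvx i j :
  (\sum_u walk_sum (i + j) u u) ^+ 2 <=
  (\sum_u walk_sum (i + i) u u) * (\sum_u walk_sum (j + j) u u).
Proof. by rewrite !walk_trace; apply: cauchy_schwarz_sum. Qed.

Lemma walk_sum_join a b c u v :
  \sum_x \sum_y walk_sum a u x * walk_sum b x y * walk_sum c y v =
  walk_sum (a + (b + c)) u v.
Proof.
rewrite walk_sumD; apply: eq_bigr => x _.
by rewrite walk_sumD mulr_sumr; apply: eq_bigr => y _; rewrite mulrA.
Qed.

(** * Degenerate pairs of walks *)

(** For [k]-walks from [x] with a common end, this fails exactly when they are internally disjoint
    paths; [take k.-1] discards the common end. *)
Definition degenerate (k : nat) (x : T) (P Q : seq T) : bool :=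
  [|| ~~ uniq (x :: P), ~~ uniq (x :: Q)
    | has (mem (take k.-1 P)) (take k.-1 Q)].

Definition degenerate_sum (k : nat) (x y : T) : R :=
  \sum_(P : k.-tuple T | last x P == y) \sum_(Q : k.-tuple T | last x Q == y)
    (degenerate k x P Q)%:R * (walk_weight x P * walk_weight x Q).

Lemma last_take_nth x (s : seq T) i :
  (i <= size s)%N -> last x (take i s) = nth x (x :: s) i.
Proof.
move=> le_is; rewrite (last_nth x) size_takel //.
by case: i le_is => [//|i] le_is; rewrite /= nth_take.
Qed.

(** Position [i] of a walk is [last x (take i P)], position [0] being [x]. The first term detects
    repetitions within a walk, the second meetings of interior positions. *)
Definition coincidences (k i j : nat) (x : T) (P Q : seq T) : R :=
  (i < j)%N%:R * ((last x (take i P) == last x (take j P))%:R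
                + (last x (take i Q) == last x (take j Q))%:R)
  + ((0 < i < k)%N && (0 < j < k)%N)%:R
      * (last x (take i P) == last x (take j Q))%:R.

Lemma coincidences_ge0 k i j x P Q : 0 <= coincidences k i j x P Q.
Proof. by rewrite addr_ge0 // ?mulr_ge0 // addr_ge0. Qed.

Lemma degenerate_le k x (P Q : k.-tuple T) :
  (degenerate k x P Q)%:R <=
    \sum_(i < k.+1) \sum_(j < k.+1) coincidences k i j x P Q.
Proof.
have witness (i j : 'I_k.+1) : (i < j)%N &&
      ((last x (take i P) == last x (take j P))
      || (last x (take i Q) == last x (take j Q)))
    || [&& (0 < i < k)%N, (0 < j < k)%N
         & last x (take i P) == last x (take j Q)] ->
    1 <= \sum_(i < k.+1) \sum_(j < k.+1) coincidences k i j x P Q.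
  move=> h; rewrite (bigD1 i) //= (bigD1 j) //= -addrA -[X in X <= _]addr0.
  apply: lerD; last first.
    apply: addr_ge0; first by apply: sumr_ge0 => ? _; apply: coincidences_ge0.
    apply: sumr_ge0 => ? _; apply: sumr_ge0 => ? _.
    exact: coincidences_ge0.
  rewrite /coincidences.
  case/orP: h => [/andP[-> /orP[] ->]|/and3P[-> -> ->]]; rewrite /= ?mul1r.
  - by rewrite -addrA lerDl addr_ge0 // mulr_ge0.
  - by rewrite addrAC lerDr addr_ge0 // mulr_ge0.
  - by rewrite lerDr mulr_ge0 // addr_ge0.
case: (boolP (degenerate k x P Q)) => [|_]; last first.
  by apply: sumr_ge0 => i _; apply: sumr_ge0 => j _; apply: coincidences_ge0.
have szP := size_tuple P; have szQ := size_tuple Q.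
case/or3P => [/(uniqPn x)[i [j [lt_ij]]]|/(uniqPn x)[i [j [lt_ij]]]|].
- rewrite /= szP ltnS => le_jk eq_ij.
  have le_ik : (i < k.+1)%N by lia.
  apply: (witness (Ordinal le_ik) (Ordinal (le_jk : j < k.+1)%N)) => /=.
  by rewrite lt_ij !last_take_nth ?szP ?eq_ij ?eqxx //; lia.
- rewrite /= szQ ltnS => le_jk eq_ij.
  have le_ik : (i < k.+1)%N by lia.
  apply: (witness (Ordinal le_ik) (Ordinal (le_jk : j < k.+1)%N)) => /=.
  by rewrite lt_ij orbC !last_take_nth ?szQ ?eq_ij ?eqxx ?orbT //; lia.
case/hasP => z /(nthP x)[j] + <- {z}.
rewrite size_takel ?szQ ?leq_pred // => ltj.
case/(nthP x) => i; rewrite size_takel ?szP ?leq_pred // => lti.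
rewrite !nth_take // => eq_ij.
(* Index [i] in the list [P] is position [i.+1] of the walk. *)
have lti' : (i.+1 < k.+1)%N by lia.
have ltj' : (j.+1 < k.+1)%N by lia.
apply: (witness (Ordinal lti') (Ordinal ltj')) => /=.
rewrite !last_take_nth ?szP ?szQ /= ?eq_ij ?eqxx //; lia.
Qed.

(** [P] followed by the reverse of [Q] is a closed walk of length [2k]; the repetition in [P] cuts
    it at [u] into closed walks of lengths [j - i] and [2k - (j - i)]. *)
Lemma sum_walk_pairs_return k i j : (i < j <= k)%N ->
  \sum_x \sum_y \sum_(P : k.-tuple T | last x P == y)
    \sum_(Q : k.-tuple T | last x Q == y)
    (last x (take i P) == last x (take j P))%:R
      * (walk_weight x P * walk_weight x Q) =
  \sum_u walk_sum (j - i) u u * walk_sum (k + k - (j - i)) u u.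
Proof.
move=> /andP[lt_ij le_jk].
have [l [b [-> ->]]] : exists l b, j = (i + l)%N /\ k = (i + (l + b))%N.
  by exists (j - i)%N, (k - j)%N; lia.
transitivity (\sum_x \sum_y \sum_u
    walk_sum i x u * (walk_sum l u u * walk_sum b u y)
      * walk_sum (i + (l + b)) x y).
  apply: eq_bigr => x _; apply: eq_bigr => y _.
  rewrite -mulr_suml -sum_walk_return mulr_suml; apply: eq_bigr => P _.
  by rewrite mulr_sumr; apply: eq_bigr => Q _; ring.
rewrite addKn (eq_bigr _ (fun x _ => exchange_big _ _ _ _ _ _)) exchange_big /=.
apply: eq_bigr => u _.
have -> : (i + (l + b) + (i + (l + b)) - l = i + (i + (l + b) + b))%N by lia.
rewrite -walk_sum_join mulr_sumr; apply: eq_bigr => x _.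
rewrite mulr_sumr; apply: eq_bigr => y _.
by rewrite (walk_sum_sym i x u) (walk_sum_sym b u y); ring.
Qed.

(** In the same closed walk, the stretch through [x] between the two meeting positions has length
    [i + j]. *)
Lemma sum_walk_pairs_meet k i j : (i <= k)%N -> (j <= k)%N ->
  \sum_x \sum_y \sum_(P : k.-tuple T | last x P == y)
    \sum_(Q : k.-tuple T | last x Q == y)
    (last x (take i P) == last x (take j Q))%:R
      * (walk_weight x P * walk_weight x Q) =
  \sum_u walk_sum (i + j) u u * walk_sum (k + k - (i + j)) u u.
Proof.
move=> le_ik le_jk.
have pinned m x y u : (m <= k)%N ->
    \sum_(s : k.-tuple T | last x s == y)
       walk_weight x s * (last x (take m s) == u)%:R =
    walk_sum m x u * walk_sum (k - m) u y.
  by move=> le_mk; have := sum_walk_pinned m (k - m) x y u; rewrite subnKC.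
transitivity (\sum_x \sum_y \sum_u
    (walk_sum i x u * walk_sum (k - i) u y)
      * (walk_sum j x u * walk_sum (k - j) u y)).
  apply: eq_bigr => x _; apply: eq_bigr => y _.
  rewrite -(eq_bigr _ (fun u _ =>
    congr2 _ (pinned i x y u le_ik) (pinned j x y u le_jk))).
  rewrite (eq_bigr _ (fun u _ => big_distrlr _ _ _ _ _ _ _)) /=.
  rewrite [RHS]exchange_big; apply: eq_bigr => P _ /=.
  rewrite [RHS]exchange_big; apply: eq_bigr => Q _ /=.
  rewrite [RHS](bigD1 (last x (take i P))) //= eqxx mulr1 big1 ?addr0.
    by rewrite [last x (take j Q) == _]eq_sym; ring.
  by move=> u /negPf h; rewrite eq_sym h mulr0 mul0r.
rewrite (eq_bigr _ (fun x _ => exchange_big _ _ _ _ _ _)) exchange_big /=.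
apply: eq_bigr => u _.
have -> : (k + k - (i + j) = k - i + (k - j))%N by lia.
rewrite !walk_sumD big_distrlr /=; apply: eq_bigr => x _; apply: eq_bigr => y _.
by rewrite (walk_sum_sym i x u) (walk_sum_sym (k - j) u y); ring.
Qed.

(** The union bound runs over [(k + 1) ^ 2] pairs of positions, each with three possible
    coincidences: within [P], within [Q], or between them. *)
Lemma degenerate_sum_le k (M : R) : (0 < k)%N -> 0 <= M ->
  (forall l, (0 < l < k + k)%N ->
     \sum_u walk_sum l u u * walk_sum (k + k - l) u u <= M) ->
  \sum_x \sum_y degenerate_sum k x y <= (k.+1 ^ 2 * 3)%:R * M.
Proof.
move=> k_gt0 M_ge0 le_M.
pose S (f : T -> seq T -> seq T -> R) := \sum_x \sum_y
  \sum_(P : k.-tuple T | last x P == y) \sum_(Q : k.-tuple T | last x Q == y)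
    f x P Q * (walk_weight x P * walk_weight x Q).
have leS (f g : T -> seq T -> seq T -> R) :
    (forall x (P Q : k.-tuple T), f x P Q <= g x P Q) -> S f <= S g.
  move=> le_fg; do 4!apply: ler_sum => ? _.
  by rewrite ler_wpM2r // mulr_ge0 // walk_weight_ge0.
have S_sum (J : finType) (f : J -> T -> seq T -> seq T -> R) :
    S (fun x P Q => \sum_j f j x P Q) = \sum_j S (f j).
  rewrite [RHS]exchange_big; apply: eq_bigr => x _ /=.
  rewrite [RHS]exchange_big; apply: eq_bigr => y _ /=.
  rewrite [RHS]exchange_big; apply: eq_bigr => P _ /=.
  rewrite [RHS]exchange_big; apply: eq_bigr => Q _ /=.
  by rewrite mulr_suml.
have SD (f g : T -> seq T -> seq T -> R) :
    S (fun x P Q => f x P Q + g x P Q) = S f + S g.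
  rewrite /S; do 4!(rewrite -big_split; apply: eq_bigr => ? _ /=).
  by rewrite mulrDl.
have SZ c (f : T -> seq T -> seq T -> R) :
    S (fun x P Q => c * f x P Q) = c * S f.
  rewrite /S; do 4!(rewrite mulr_sumr; apply: eq_bigr => ? _ /=).
  by rewrite -mulrA.
have S_swap (f : T -> seq T -> seq T -> R) : S (fun x P Q => f x Q P) = S f.
  apply: eq_bigr => x _; apply: eq_bigr => y _; rewrite exchange_big.
  by do 2!(apply: eq_bigr => ? _); rewrite [X in _ * X]mulrC.
apply: (@le_trans _ _ (S (fun x P Q =>
    \sum_(i < k.+1) \sum_(j < k.+1) coincidences k i j x P Q))).
  apply: (leS (fun x P Q => (degenerate k x P Q)%:R)) => x P Q.
  exact: degenerate_le.
rewrite S_sum natrM natrX -mulrA expr2 -mulrA mulr_natl.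
rewrite -[X in _ *+ X]card_ord -sumr_const; apply: ler_sum => i _.
rewrite S_sum mulr_natl -[X in _ *+ X]card_ord -sumr_const.
apply: ler_sum => j _.
rewrite SD SZ SD SZ (S_swap (fun x P Q =>
  (last x (take i P) == last x (take j P))%:R)).
have -> : 3%:R * M = 1 * (M + M) + 1 * M by ring.
have bd (c : bool) (s t : R) : 0 <= t -> (c -> s <= t) -> c%:R * s <= 1 * t.
  by case: c => t_ge0 h; rewrite ?mul0r !mul1r // h.
apply: lerD; apply: bd; rewrite ?addr_ge0 //.
  move=> lt_ij; have lt_j := ltn_ord j.
  rewrite /S sum_walk_pairs_return; last by lia.
  by apply: lerD; apply: le_M; lia.
move=> lt_ij; rewrite /S sum_walk_pairs_meet; try by have := ltn_ord j; lia.
by apply: le_M; lia.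
Qed.

(** * Traces of even powers and the choice of branch vertices *)

Hypothesis w_diag : forall x, w x x = 0.

Lemma degenerate_sum_trace k (d : R) : (0 < k)%N -> 0 < d ->
  (forall u, walk_sum 2 u u <= d^-1) ->
  \sum_x \sum_y degenerate_sum k x y <=
    (k.+1 ^ 2 * 3)%:R * (d^-1 * \sum_u walk_sum (k.-1 + k.-1) u u).
Proof.
move=> k_gt0 d_gt0 le_d; apply: degenerate_sum_le => // [|l lt_l].
  rewrite mulr_ge0 ?invr_ge0 ?(ltW d_gt0) //.
  by apply: sumr_ge0 => u _; apply: walk_sum_ge0.
rewrite mulr_sumr; apply: ler_sum => u _.
have := @logconvex_middle R (fun m => walk_sum m u u) k l _ _ _ lt_l.
move=> /(_ (fun m => walk_sum_ge0 m u u) (fun i j => walk_sum_cvx i j u)).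
rewrite walk_sum1 w_diag => /(_ erefl)/le_trans; apply.
by rewrite ler_wpM2r ?walk_sum_ge0.
Qed.

(** Log-convexity of the traces of even powers, starting from the trace [#|T|] of the identity. *)
Lemma walk_trace_pow k : (0 < k)%N ->
  (\sum_u walk_sum (k.-1 + k.-1) u u) ^+ k <=
    #|T|%:R * (\sum_u walk_sum (k + k) u u) ^+ k.-1.
Proof.
case: k => [//|k] _ /=.
have := @logconvex_pow R (fun j => \sum_u walk_sum (j + j) u u) _ _ k.
have -> : \sum_u walk_sum (0 + 0) u u = #|T|%:R.
  rewrite addn0 -sum1_card natr_sum.
  by apply: eq_bigr => u _; rewrite walk_sum0 eqxx.
apply=> j; first by apply: sumr_ge0 => u _; apply: walk_sum_ge0.
by have := walk_trace_cvx j j.+2; rewrite addSn !addnS.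
Qed.

(** With [t] and [t'] the traces of the powers [2k] and [2k - 2], failure would give [(d t) ^ k <=
    (K t') ^ k <= K ^ k #|T| t ^ (k - 1) <= K ^ k #|T| t ^ k], the last step by [t >= 1]. *)
Lemma walk_trace_lt k (d : R) (K : nat) : (0 < k)%N -> 0 < d ->
  1 <= \sum_u walk_sum (k + k) u u -> K%:R ^+ k * #|T|%:R < d ^+ k ->
  K%:R * (\sum_u walk_sum (k.-1 + k.-1) u u) < d * \sum_u walk_sum (k + k) u u.
Proof.
move=> k_gt0 d_gt0 trace_ge1 lt_d; have := walk_trace_pow k k_gt0.
set t' := \sum_u walk_sum (k.-1 + k.-1) u u.
set t := \sum_u walk_sum (k + k) u u in trace_ge1 *.
have t_gt0 : 0 < t by apply: lt_le_trans trace_ge1.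
move=> le_t'; rewrite ltNge; apply/negP => le_dt.
have : (d * t) ^+ k <= (K%:R * t') ^+ k.
  by apply: lerXn2r => //; rewrite nnegrE ?(le_trans _ le_dt) ?mulr_ge0 ?ltW.
rewrite leNgt => /negP; apply; rewrite !exprMn.
apply: (@le_lt_trans _ _ (K%:R ^+ k * #|T|%:R * t ^+ k)); last first.
  by rewrite ltr_pM2r ?exprn_gt0.
rewrite -mulrA ler_wpM2l ?exprn_ge0 //; apply: le_trans le_t' _.
by rewrite ler_wpM2l // ler_weXn2l // leq_pred.
Qed.

(** Random selection is applied twice: to branch vertices, then to [L] walks between two of them.
    The factors [#|I| ^ 2] and [L ^ 2] pay for the two union bounds, the rest for the
    coincidences. *)
Lemma rich_pairs {I : finType} (L h : nat) (d : R) :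
  let k := (h + h)%N in (0 < h)%N -> 0 < d ->
  (forall u, walk_sum 2 u u <= d^-1) ->
  1 <= \sum_u walk_sum (k + k) u u ->
  (#|I| ^ 2 * (L ^ 2 * (k.+1 ^ 2 * 3)))%:R ^+ k * #|T|%:R < d ^+ k ->
  exists g : I -> T, forall i j, i != j ->
    exists P : 'I_L -> k.-tuple T,
      (forall l, 0 < walk_weight (g i) (P l) /\ last (g i) (P l) = g j) /\
      (forall l l', l != l' -> ~~ degenerate k (g i) (P l) (P l')).
Proof.
move=> k h_gt0 d_gt0 le_d trace_ge1 lt_d.
have k_gt0 : (0 < k)%N by rewrite /k; lia.
have D_ge0 x y : 0 <= degenerate_sum k x y.
  by do 2!apply: sumr_ge0 => ? _; rewrite !mulr_ge0 ?walk_weight_ge0.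
(* A pair that is not bad satisfies exactly the hypothesis for selecting [L] pairwise nondegenerate
   walks from [x] to [y]. *)
pose bad : rel T := fun x y =>
  walk_sum k x y ^+ 2 <= L%:R ^+ 2 * degenerate_sum k x y.
pose mu (vz : T * T) x := walk_sum h vz.1 x * walk_sum h x vz.2.
have mu_ge0 vz x : 0 <= mu vz x by rewrite mulr_ge0 ?walk_sum_ge0.
have sum_mu x y : \sum_vz mu vz x * mu vz y = walk_sum k x y ^+ 2.
  rewrite expr2 (walk_sumD h h) big_distrlr pair_big /=.
  apply: eq_bigr => -[v z] _; rewrite /mu /=.
  by rewrite (walk_sum_sym h v x) (walk_sum_sym h y z); ring.
have bad_bound : #|I|%:R ^+ 2 *
    (\sum_x \sum_y (bad x y)%:R * walk_sum k x y ^+ 2) <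
    \sum_x \sum_y walk_sum k x y ^+ 2.
  have -> : \sum_x \sum_y walk_sum k x y ^+ 2 = \sum_u walk_sum (k + k) u u.
    by rewrite walk_trace pair_big; apply: eq_bigr => p _.
  rewrite -(ltr_pM2l d_gt0).
  apply: le_lt_trans (walk_trace_lt k d _ k_gt0 d_gt0 trace_ge1 lt_d).
  rewrite mulrCA [(#|I| ^ 2 * _)%:R]natrM -mulrA natrX.
  rewrite ler_wpM2l ?exprn_ge0 // natrM natrX -mulrA.
  have le_D : d * (\sum_x \sum_y degenerate_sum k x y) <=
      (k.+1 ^ 2 * 3)%:R * \sum_u walk_sum (k.-1 + k.-1) u u.
    rewrite -ler_pdivlMl // mulrCA.
    exact: (degenerate_sum_trace k d k_gt0 d_gt0 le_d).
  apply: le_trans (ler_wpM2l (sqr_ge0 L%:R) le_D).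
  rewrite mulrCA ler_wpM2l ?(ltW d_gt0) // mulr_sumr; apply: ler_sum => x _.
  rewrite mulr_sumr; apply: ler_sum => y _.
  case: (boolP (bad x y)) => [|_]; first by rewrite mul1r.
  by rewrite mul0r mulr_ge0 ?exprn_ge0.
(* Summed over [vz], the two sides become those of [bad_bound], so some [vz] satisfies the strict
   inequality. *)
have [vz lt_vz] : exists vz, #|I|%:R ^+ 2 *
    (\sum_x \sum_y (bad x y)%:R * (mu vz x * mu vz y)) < (\sum_x mu vz x) ^+ 2.
  apply/existsP; apply: contraLR bad_bound => /existsPn h_vz.
  rewrite -leNgt.
  have -> : \sum_x \sum_y walk_sum k x y ^+ 2 = \sum_vz (\sum_x mu vz x) ^+ 2.
    under [RHS]eq_bigr do rewrite expr2 big_distrlr /=.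
    rewrite [RHS]exchange_big; apply: eq_bigr => x _ /=.
    by rewrite [RHS]exchange_big; apply: eq_bigr => y _ /=; rewrite sum_mu.
  have -> : \sum_x \sum_y (bad x y)%:R * walk_sum k x y ^+ 2 =
      \sum_vz \sum_x \sum_y (bad x y)%:R * (mu vz x * mu vz y).
    rewrite [RHS]exchange_big; apply: eq_bigr => x _ /=.
    rewrite [RHS]exchange_big; apply: eq_bigr => y _ /=.
    by rewrite -sum_mu mulr_sumr.
  by rewrite mulr_sumr; apply: ler_sum => vz _; rewrite leNgt.
have [g [_ good_g]] := random_selection bad (mu_ge0 vz) lt_vz.
exists g => i j /good_g; rewrite /bad -ltNge => lt_q.
(* Up to normalization, the law of a weighted random [k]-walk from [g i] conditioned to end at
   [g j]. *)
pose nu (s : k.-tuple T) := (last (g i) s == g j)%:R * walk_weight (g i) s.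
have nu_ge0 s : 0 <= nu s by rewrite mulr_ge0 ?walk_weight_ge0.
have := @random_selection R 'I_L _ nu
  (fun P Q => degenerate k (g i) P Q) nu_ge0.
rewrite card_ord => /(_ _)[|P [nu_gt0 nondeg]].
  have -> : \sum_s nu s = walk_sum k (g i) (g j).
    by rewrite walk_sumE; apply: eq_bigr => s _; rewrite mulrC.
  congr (_ < _): lt_q; congr (_ * _).
  rewrite /degenerate_sum big_mkcond; apply: eq_bigr => P _.
  case: eqP => lastP; last first.
    rewrite big1 // => Q _.
    by rewrite /nu (introF eqP lastP) !mul0r mulr0.
  rewrite big_mkcond; apply: eq_bigr => Q _; rewrite /nu lastP eqxx mul1r.
  by case: eqP; rewrite ?mul1r ?mul0r ?mulr0.
exists P; split=> // l; have := nu_gt0 l; rewrite /nu.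
by case: eqP => [->|]; rewrite ?mul1r ?mul0r ?ltxx.
Qed.

End WeightedWalks.

(** * Normalized adjacency weights *)

Section NormalizedAdjacency.
Context (R : rcfType) {T : finType} (e : rel T).
Hypothesis e_sym : symmetric e.
Hypothesis e_irr : irreflexive e.

Let deg x := #|e x|.

(* The symmetric normalization has top eigenvalue 1 whatever the degrees, so
   that no almost-regularity of the graph is needed: a lower bound on the
   nonzero degrees suffices. *)
Definition adj_weight (x y : T) : R :=
  (e x y)%:R / (Num.sqrt (deg x)%:R * Num.sqrt (deg y)%:R).

Lemma adj_weight_sym x y : adj_weight x y = adj_weight y x.
Proof. by rewrite /adj_weight e_sym mulrC [_ * Num.sqrt _]mulrC mulrC. Qed.

Lemma adj_weight_ge0 x y : 0 <= adj_weight x y.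
Proof. by rewrite divr_ge0 // mulr_ge0 // sqrtr_ge0. Qed.

Lemma adj_weight_diag x : adj_weight x x = 0.
Proof. by rewrite /adj_weight e_irr mul0r. Qed.

Lemma deg_gt0 x y : e x y -> (0 < deg x)%N.
Proof. by move=> exy; apply/card_gt0P; exists y. Qed.

Lemma sum_adj x (c : R) : \sum_y (e x y)%:R * c = (deg x)%:R * c.
Proof.
rewrite -mulr_suml -natr_sum; congr (_%:R * _).
by rewrite -big_mkcond sum1_card.
Qed.

(** Each of the [deg u] neighbours [y] of [u] contributes [1 / (deg u * deg y)], at most
    [1 / (deg u * d)]. *)
Lemma walk_sum2_adj_le (d : nat) u : (0 < d)%N ->
  (forall x, (deg x == 0)%N || (d <= deg x)%N) ->
  walk_sum adj_weight 2 u u <= d%:R^-1.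
Proof.
move=> d_gt0 deg_ge; rewrite (walk_sumD _ 1 1).
apply: (@le_trans _ _ (\sum_y (e u y)%:R * ((deg u)%:R^-1 * d%:R^-1))).
  apply: ler_sum => y _; rewrite !walk_sum1 (adj_weight_sym y) /adj_weight.
  have [euy|_] := boolP (e u y); last by rewrite !mul0r.
  have du := deg_gt0 _ _ euy; have eyu : e y u by rewrite e_sym.
  have dy := deg_gt0 _ _ eyu.
  rewrite !mul1r -expr2 exprVn exprMn !sqr_sqrtr // -invfM lef_pV2 ?posrE.
  - rewrite ler_wpM2l // ler_nat.
    by have := deg_ge y; rewrite eqn0Ngt dy.
  - by rewrite mulr_gt0 ?ltr0n.
  - by rewrite mulr_gt0 ?ltr0n.
rewrite sum_adj mulrA; have [->|du] := eqVneq (deg u) 0%N.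
  by rewrite !mul0r invr_ge0.
by rewrite divff ?mul1r // pnatr_eq0.
Qed.

(** The vector of square roots of degrees is fixed by the matrix, hence by its powers; its entries
    at isolated vertices are zero. *)
Lemma sum_walk_sum_adj m x :
  \sum_y walk_sum adj_weight m x y * Num.sqrt (deg y)%:R = Num.sqrt (deg x)%:R.
Proof.
elim: m x => [|m IH] x.
  rewrite (bigD1 x) //= walk_sum0 eqxx mul1r big1 ?addr0 // => y.
  by rewrite walk_sum0 eq_sym => /negPf ->; rewrite mul0r.
rewrite (eq_bigr _ (fun y _ => congr1 (fun t => t * _) (walk_sumD _ 1 m x y))).
under eq_bigr do rewrite mulr_suml.
rewrite exchange_big /=.
under eq_bigr do under eq_bigr do rewrite -mulrA.
under eq_bigr do rewrite -mulr_sumr IH walk_sum1.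
have sqrt_neq0 y : (0 < deg y)%N -> Num.sqrt ((deg y)%:R : R) != 0.
  by move=> dy; rewrite gt_eqF // sqrtr_gt0 ltr0n.
transitivity (\sum_y (e x y)%:R * (Num.sqrt (deg x)%:R)^-1 : R).
  apply: eq_bigr => y _; rewrite /adj_weight.
  have [exy|_] := boolP (e x y); last by rewrite !mul0r.
  have eyx : e y x by rewrite e_sym.
  by rewrite !mul1r invfM mulfVK // sqrt_neq0 // (deg_gt0 y x).
rewrite sum_adj; case: (posnP (deg x)) => [->|dx].
  by rewrite sqrtr0 mul0r.
by rewrite -{1}[(deg x)%:R]sqr_sqrtr // expr2 mulfK // sqrt_neq0.
Qed.

(** Cauchy-Schwarz for the matrix [v x * v y], with [v] the fixed vector, against the [k]-th power
    gives [S ^ 2 <= S ^ 2 * t] with [t] the trace; the edge makes [S] positive. *)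
Lemma walk_trace_adj_ge1 k x0 y0 : e x0 y0 ->
  1 <= \sum_u walk_sum adj_weight (k + k) u u.
Proof.
move=> e0; rewrite (walk_trace _ adj_weight_sym).
pose v x : R := Num.sqrt (deg x)%:R.
pose S : R := \sum_x v x ^+ 2.
have S_gt0 : 0 < S.
  rewrite /S (bigD1 x0) //= ltr_pwDl //.
    by rewrite exprn_gt0 // sqrtr_gt0 ltr0n (deg_gt0 _ _ e0).
  by apply: sumr_ge0 => x _; apply: sqr_ge0.
have := cauchy_schwarz_sum (fun p : T * T => v p.1 * v p.2)
  (fun p => walk_sum adj_weight k p.1 p.2).
have -> : \sum_(p : T * T) v p.1 * v p.2 * walk_sum adj_weight k p.1 p.2 = S.
  rewrite -(pair_big xpredT xpredT
    (fun x y => v x * v y * walk_sum adj_weight k x y)).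
  apply: eq_bigr => x _ /=.
  rewrite expr2 -[X in _ = _ * X](sum_walk_sum_adj k x) mulr_sumr.
  by apply: eq_bigr => y _; rewrite -mulrA [v y * _]mulrC.
have -> : \sum_(p : T * T) (v p.1 * v p.2) ^+ 2 = S ^+ 2.
  rewrite -(pair_big xpredT xpredT (fun x y => (v x * v y) ^+ 2)) /= expr2.
  rewrite big_distrlr; apply: eq_bigr => x _; apply: eq_bigr => y _.
  by rewrite exprMn.
by rewrite -[X in X <= _]mulr1 ler_pM2l ?exprn_gt0.
Qed.

Lemma walk_weight_path x s : 0 < walk_weight adj_weight x s -> path e x s.
Proof.
elim: s x => [//|y s IH] x /=.
have [exy|nexy] := boolP (e x y); last first.
  by rewrite /adj_weight (negPf nexy) !mul0r ltxx.
move=> h; apply: IH; move: h; apply: contraTT; rewrite -!leNgt => h.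
by rewrite mulr_ge0_le0 // adj_weight_ge0.
Qed.

Lemma rich_paths {I : finType} (L h d : nat) x0 y0 :
  let k := (h + h)%N in (0 < h)%N -> (0 < d)%N -> e x0 y0 ->
  (forall x, (deg x == 0)%N || (d <= deg x)%N) ->
  ((#|I| ^ 2 * (L ^ 2 * (k.+1 ^ 2 * 3))) ^ k * #|T| < d ^ k)%N ->
  exists g : I -> T, forall i j, i != j ->
    exists P : 'I_L -> k.-tuple T,
      (forall l, path e (g i) (P l) /\ last (g i) (P l) = g j) /\
      (forall l l', l != l' -> ~~ degenerate k (g i) (P l) (P l')).
Proof.
move=> k h_gt0 d_gt0 e0 deg_ge lt_d.
have [] := @rich_pairs R T _ adj_weight_sym adj_weight_ge0 adj_weight_diag
  I L h d%:R h_gt0.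
- by rewrite ltr0n.
- by move=> u; apply: walk_sum2_adj_le.
- exact: (walk_trace_adj_ge1 _ x0 y0).
- by rewrite -!natrX -natrM ltr_nat.
move=> g rich_g; exists g => i j /rich_g[P [hP nondeg]]; exists P; split=> // l.
by have [/walk_weight_path] := hP l.
Qed.

End NormalizedAdjacency.

(** * Embedding a subdivision *)

(** Greedy choice along a list of [E]: fewer than [L] vertices are ever in use, and each lies in at
    most one of the [L] disjoint candidates, so some candidate avoids them all. *)
Lemma disjoint_choice {E T : finType} (L m : nat) (A : E -> 'I_L -> {set T})
    (X : {set T}) :
  (forall e l, #|A e l| <= m)%N ->
  (forall e l l', l != l' -> [disjoint A e l & A e l']) ->
  (#|X| + #|E| * m < L)%N ->
  exists c : E -> 'I_L, (forall e, [disjoint X & A e (c e)]) /\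
    (forall e e', e != e' -> [disjoint A e (c e) & A e' (c e')]).
Proof.
move=> card_A disj_A lt_L.
suff [c [cX cA]] : exists c : E -> 'I_L,
    {in enum E, forall e, [disjoint X & A e (c e)]} /\
    {in enum E &, forall e e', e != e' -> [disjoint A e (c e) & A e' (c e')]}.
  exists c; split=> [e|e e' neq_ee']; first by apply: cX; rewrite mem_enum.
  by apply: cA neq_ee'; rewrite mem_enum.
have: (size (enum E) <= #|E|)%N by rewrite cardE.
elim: (enum E) => [|e s IH] /= lt_s.
  by exists (fun=> Ordinal (leq_ltn_trans (leq0n _) lt_L)).
have [c [cX cA]] := IH (ltnW lt_s).
have [es|e_s] := boolP (e \in s).
  exists c; split=> [x|x y]; rewrite !inE.
    by move=> /predU1P[->|]; [apply: cX | apply: cX].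
  by move=> /predU1P[->|xs] /predU1P[->|ys]; apply: cA.
pose Z : {set T} := (X :|: \bigcup_(x <- s) A x (c x))%SET.
have card_Z : (#|Z| < L)%N.
  apply: leq_ltn_trans lt_L; apply: leq_trans (leq_card_setU _ _) _.
  rewrite leq_add2l; apply: (@leq_trans (size s * m)); last first.
    by rewrite leq_mul2r (ltnW lt_s) orbT.
  elim: (s) => [|x s' IHs]; first by rewrite big_nil cards0.
  rewrite big_cons mulSn; apply: leq_trans (leq_card_setU _ _) _.
  exact: leq_add.
have [l Zl] : exists l, [disjoint Z & A e l].
  apply/existsP; apply: contraLR card_Z => /existsPn hit; rewrite -leqNgt.
  (* If every candidate met [Z], the common points [z l] would inject ['I_L] into [Z]. *)
  have /fin_all_exists[z zP] l : exists z, (z \in Z) && (z \in A e l).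
    have /pred0Pn[z zP] := hit l; by exists z.
  have z_inj : injective z.
    move=> l l' eq_z; apply/eqP; apply: contraT.
    move=> /(disj_A e)/pred0P/(_ (z l)).
    have /andP[_ zl] := zP l; have /andP[_ zl'] := zP l'.
    by rewrite /= zl eq_z zl'.
  rewrite -[X in (X <= _)%N]card_ord -(card_codom z_inj).
  apply: subset_leq_card; apply/subsetP => _ /codomP[l ->].
  by case/andP: (zP l).
have XZ : X \subset Z by apply: subsetUl.
have AZ x : x \in s -> A x (c x) \subset Z.
  move=> xs; apply: subset_trans (subsetUr _ _).
  by rewrite (big_rem x) //= subsetUl.
exists (fun x => if x == e then l else c x); split=> [x|x y]; rewrite !inE.
  have [-> _|_ /=] := eqVneq x e; last exact: cX.
  exact: disjointWl Zl.
have [->|_] := eqVneq x e; have [->|_] := eqVneq y e => //=.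
- by move=> _ ys _; rewrite disjoint_sym; apply: disjointWl (AZ y ys) Zl.
- by move=> xs _ _; apply: disjointWl (AZ x xs) Zl.
exact: cA.
Qed.

(** Take a minimal [S] spanning more than [d * #|S|] edges: deleting a vertex with fewer than [d]
    neighbours in [S] would leave a smaller such set. *)
Lemma min_degree_subset {T : finType} {G : {set {set T}}} (d : nat) :
  is_graph G -> (d * #|T| < #|G|)%N ->
  exists2 S : {set T}, (0 < #|S|)%N &
    forall x, x \in S -> (d <= #|[pred y in S | ([set x; y] \in G)%SET]|)%N.
Proof.
move=> /forall_inP graph_G lt_d.
pose inside (S : {set T}) : {set {set T}} := [set A in G | A \subset S]%SET.
pose dense (S : {set T}) := (d * #|S| < #|inside S|)%N.
have denseT : dense (finset xpredT).
  rewrite /dense cardsT; apply: leq_trans lt_d _; apply: subset_leq_card.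
  by apply/subsetP => A AG; rewrite inE AG subsetT.
have [S /minsetP[denseS minS]] := ex_minset (ex_intro dense _ denseT).
exists S.
  rewrite card_gt0; apply: contraTneq denseS => ->.
  rewrite /dense cards0 muln0 -leqNgt leqn0 cards_eq0 -subset0.
  apply/subsetP => A; rewrite !inE subset0 => /andP[/graph_G + /eqP A0].
  by rewrite A0 cards0.
move=> x xS; rewrite leqNgt; apply/negP => lt_deg.
have /minS : dense (S :\ x)%SET.
  rewrite /dense; move: denseS; rewrite /dense (cardsD1 x S) xS mulnDr muln1.
  set N := [pred y in S | _] in lt_deg.
  have : (#|inside S| <= #|inside (S :\ x)%SET| + #|N|)%N.
    apply: leq_trans (leq_add (leqnn _)
      (leq_imset_card (fun y => [set x; y]%SET) N)).
    apply: leq_trans (leq_card_setU _ _); apply: subset_leq_card.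
    apply/subsetP => A; rewrite !inE => /andP[AG AS]; rewrite AG subsetD1 AS /=.
    case: (boolP (x \in A)) => //= xA; apply/imsetP.
    have /cards2P[a [b [_ eA]]] := graph_G A AG.
    have [y eAy] : exists y, A = [set x; y]%SET.
      move: xA; rewrite eA !inE => /orP[] /eqP ->; first by exists b.
      by exists a; rewrite setUC.
    exists y => //; rewrite !inE -eAy AG andbT (subsetP AS) // eAy !inE eqxx.
    by rewrite orbT.
  lia.
rewrite subD1set => /(_ isT) eS.
by have := setD11 x S; rewrite eS xS.
Qed.

(** [L] exceeds the number of branch vertices plus a bound on the interior vertices of all paths, so
    the greedy choice never runs out of candidates. *)
Lemma contains_subdivision (R : rcfType) (F : multigraph) {T : finType}
    (G : {set {set T}}) (h d : nat) :
  let k := (h + h)%N in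
  let L := (#|vert F| + #|edge F| * k).+1 in
  (0 < h)%N -> is_graph G -> (d * #|T| < #|G|)%N ->
  ((#|vert F| ^ 2 * (L ^ 2 * (k.+1 ^ 2 * 3))) ^ k * #|T| < d ^ k)%N ->
  contains G (subdivision F k.-1).
Proof.
move=> k L h_gt0 graph_G lt_dG lt_d.
have k_gt0 : (0 < k)%N by rewrite /k; lia.
have d_gt0 : (0 < d)%N by case: (d) lt_d => [|//]; rewrite exp0n.
have [S /card_gt0P[x0 x0S] degS] := min_degree_subset d graph_G lt_dG.
(* The graph induced on [S], kept on the type [T]: vertices outside [S] become isolated, which the
   degree condition of [rich_paths] allows. *)
pose e x y := [&& x \in S, y \in S & ([set x; y] \in G)%SET].
have e_sym : symmetric e by move=> x y; rewrite /e setUC andbCA.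
have e_irr : irreflexive e.
  move=> x; apply/negP => /and3P[_ _ /(forall_inP graph_G)].
  by rewrite setUid cards1.
have deg_e x : (#|e x| == 0)%N || (d <= #|e x|)%N.
  have [xS|/negPf xS] := boolP (x \in S).
    apply/orP; right; apply: leq_trans (degS x xS) _; apply: subset_leq_card.
    by apply/subsetP => y; rewrite !inE /in_mem /= /e xS.
  by apply/orP; left; apply/eqP; apply: eq_card0 => y; rewrite /in_mem /= /e xS.
have [y0 e0] : exists y, e x0 y.
  have /card_gt0P[y] := leq_trans d_gt0 (degS x0 x0S).
  by rewrite !inE => /andP[yS xyG]; exists y; rewrite /e x0S yS.
have [g rich_g] :=
  rich_paths R e e_sym e_irr L h d x0 y0 h_gt0 d_gt0 e0 deg_e lt_d.
(* Nondegeneracy concerns two different indices, so a second index is needed to learn that a single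
   walk repeats no vertex. *)
have distinct_l (v : vert F) (l : 'I_L) : exists l', l != l'.
  have V_gt0 : (0 < #|vert F|)%N by apply/card_gt0P; exists v.
  have lt1 : (1 < L)%N by rewrite /L; lia.
  have [l0|l_neq0] := eqVneq l (Ordinal (ltnW lt1)).
    by exists (Ordinal lt1); rewrite l0.
  by exists (Ordinal (ltnW lt1)).
(* If [g i = g j], a walk of positive length [k] from [g i] to [g j] would repeat its first
   vertex. *)
have g_inj : injective g.
  move=> i j eq_g; apply/eqP; apply: contraT => /rich_g[P [pathP nondeg]].
  have [l' /nondeg] := distinct_l i ord0.
  rewrite !negb_or negbK /= => /and3P[/andP[giP _] _ _].
  have [_ last_gj] := pathP ord0; move: giP; rewrite eq_g -last_gj.
  case: (P ord0) (size_tuple (P ord0)) => -[|y s] /= _ sz.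
    by move: k_gt0; rewrite /k -sz.
  by rewrite mem_last.
have /fin_all_exists[P P_spec] (a : edge F) : exists P : 'I_L -> k.-tuple T,
    (forall l, path e (g (src a)) (P l)
      /\ last (g (src a)) (P l) = g (tgt a)) /\
    (forall l l', l != l' -> ~~ degenerate k (g (src a)) (P l) (P l')).
  by apply: rich_g; apply: loopless.
pose inner a l : {set T} := finset (mem (take k.-1 (P a l))).
have card_inner a l : (#|inner a l| <= k)%N.
  rewrite cardsE; apply: leq_trans (card_size _) _.
  by rewrite size_take size_tuple; case: ltnP => //; rewrite leq_pred.
have disj_inner a l l' : l != l' -> [disjoint inner a l & inner a l'].
  have [_ nondeg] := P_spec a; move=> /nondeg; rewrite !negb_or => /and3P[_ _].
  move=> /hasPn hP; apply/pred0P => z /=; rewrite !inE.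
  apply/negP => /andP[zl zl'].
  by have := hP z zl'; rewrite /= zl.
have [|c [cX c_disj]] := disjoint_choice L k inner (g @: finset xpredT)%SET
  card_inner disj_inner.
  by rewrite card_imset // cardsT /L ltnS.
have uniq_P a : uniq (g (src a) :: P a (c a)).
  have [l' neq_l] := distinct_l (src a) (c a).
  have [_ /(_ _ _ neq_l)] := P_spec a.
  by rewrite !negb_or negbK => /andP[].
(* The list [P a (c a)] omits the start, so its entry [j] is the internal vertex numbered [j]. *)
pose f (z : subdiv_vert F k.-1) : T := match z with
  | inl v => g v
  | inr (a, j) => nth (g (src a)) (P a (c a)) j
  end.
have f_inner a (j : 'I_k.-1) : f (inr (a, j)) \in inner a (c a).
  rewrite inE /= -(nth_take (n0 := k.-1)) // mem_nth //.
  by rewrite size_takel ?ltn_ord // size_tuple leq_pred.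
have f_inl_inr v a j : f (inl v) != f (inr (a, j)).
  apply/eqP => eq_f; have := f_inner a j; rewrite -eq_f /= => gv_inner.
  have gv_X : g v \in (g @: finset xpredT)%SET by rewrite imset_f ?inE.
  by have /pred0P/(_ (g v))/= := cX a; rewrite gv_X gv_inner.
(* In this range [path_vert] takes its default [tgt a] only at [i = k], where the walk ends. *)
have f_path (a : edge F) i : (i <= k)%N ->
    f (path_vert k.-1 a i) = nth (g (src a)) (g (src a) :: P a (c a)) i.
  case: i => [//|i] lt_ik; rewrite /path_vert.
  case: insubP => [j _ /= -> //|]; rewrite -leqNgt => le_ki.
  have -> : i = k.-1 by lia.
  have [_ last_P] := (P_spec a).1 (c a).
  rewrite /= -last_P (last_nth (g (src a))) size_tuple.
  by rewrite -[X in nth _ _ X = _](prednK k_gt0).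
apply/existsP; exists (finfun f); apply/andP; split.
  apply/injectiveP => z z'; rewrite !ffunE.
  case: z z' => [v|[a j]] [v'|[a' j']].
  - by move=> /g_inj ->.
  - by move=> eq_f; have := f_inl_inr v a' j'; rewrite eq_f eqxx.
  - by move=> eq_f; have := f_inl_inr v' a j; rewrite eq_f eqxx.
  have [<-|neq_a] := eqVneq a a'.
    have /andP[_ uP] := uniq_P a => /eqP.
    rewrite nth_uniq ?size_tuple //; first by move=> /eqP /val_inj ->.
      by have := ltn_ord j; lia.
    by have := ltn_ord j'; lia.
  move=> eq_f; have := f_inner a' j'; rewrite -eq_f => in_a'.
  have in_a := f_inner a j; move/pred0P: (c_disj _ _ neq_a).
  by move/(_ (f (inr (a, j)))); rewrite [LHS]/= in_a in_a'.
apply/forall_inP => _ /imset2P[a i _ _ ->].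
rewrite imsetU !imset_set1 !ffunE !f_path; try by have := ltn_ord i; lia.
have [/(_ (c a))[/(pathP (g (src a))) eP _] _] := P_spec a.
have lt_i : (i < size (P a (c a)))%N.
  by rewrite size_tuple; have := ltn_ord i; lia.
by have /and3P[] := eP i lt_i.
Qed.

(* The asymptotic bound *)
From mathcomp Require Import all_classical all_reals all_analysis.
Import numFieldNormedType.Exports.
Local Open Scope classical_set_scope.
Local Open Scope ring_scope.

Lemma extremal_number_subdivision_le (R : realType) (F : multigraph)
    (k : nat) :
  (0 < k)%N -> ~~ odd k ->
  exists2 C : R, 0 < C & forall n, (0 < n)%N ->
    (extremal_number n (subdivision F k.-1))%:R <= C * n%:R `^ (1 + k%:R^-1).
Proof.
move=> k_gt0 k_even.
have eq_k : (k = k./2 + k./2)%N by rewrite addnn even_halfK.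
pose L := (#|vert F| + #|edge F| * k).+1.
(* [c.-1] is the constant required by [contains_subdivision]. *)
pose c := (#|vert F| ^ 2 * (L ^ 2 * (k.+1 ^ 2 * 3))).+1.
exists c.+1%:R => [|n n_gt0]; first by rewrite ltr0n.
have n_gt0' : 0 < n%:R :> R by rewrite ltr0n.
pose r : R := n%:R `^ k%:R^-1.
have r_gt0 : 0 < r by apply: powR_gt0.
have r_pow : r ^+ k = n%:R.
  by rewrite -powR_mulrn ?powR_ge0 // -powRrM mulVf ?powRr1 // pnatr_eq0 -lt0n.
have r_ge1 : 1 <= r.
  rewrite -(@ler_pXn2r _ k) ?nnegrE ?(ltW r_gt0) // r_pow expr1n.
  by rewrite -[1]/(1%:R) ler_nat.
(* The least integer above [c * n ^ (1 / k)]; rounding adds at most [1 <= r], whence the final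
   constant [c.+1]. *)
pose d := (Num.truncn (c%:R * r)).+1.
have lt_cr : c%:R * r < d%:R by apply: truncnS_gt.
have lt_cd : (c.-1 ^ k * n < d ^ k)%N.
  rewrite -(ltr_nat R) natrM !natrX -r_pow -exprMn ltrXn2r -?lt0n //.
    rewrite mulr_ge0 ?(ltW r_gt0) //.
  apply: le_lt_trans lt_cr; rewrite ler_wpM2r ?(ltW r_gt0) //.
  by rewrite ler_nat leq_pred.
have ex_le : (extremal_number n (subdivision F k.-1) <= d * n)%N.
  apply/bigmax_leqP => G /andP[graph_G]; apply: contraNT.
  rewrite -ltnNge => lt_dn.
  have := @contains_subdivision R F _ G k./2 d.
  rewrite /= -eq_k card_ord; apply => //.
  by move: k_gt0; rewrite {1}eq_k; lia.
apply: (@le_trans _ _ (d * n)%:R); first by rewrite ler_nat.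
rewrite powRD ?pnatr_eq0 -?lt0n ?n_gt0 ?implybT // powRr1 ?(ltW n_gt0') //.
rewrite natrM mulrCA mulrC ler_wpM2l //.
have : (Num.truncn (c%:R * r))%:R <= c%:R * r.
  by rewrite truncn_le // mulr_ge0 // ltW.
rewrite /d -natr1 -[c.+1%:R]natr1 mulrDl mul1r => h; exact: lerD.
Qed.

Theorem theorem1p6 (R : realType) (F : multigraph) (k : nat)
    (hk : (2 <= k)%N) (hk_even : ~~ odd k) :
  (fun n : nat => (extremal_number n (subdivision F k.-1))%:R : R)
    =O_\oo (fun n : nat => n%:R `^ (1 + k%:R^-1)).
Proof.
have [C C_gt0 le_C] := extremal_number_subdivision_le R F k (ltnW hk) hk_even.
apply/eqO_exP; exists C => //; near=> n.
rewrite !ger0_norm ?powR_ge0 //; apply: le_C.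
by near: n; exists 1%N.
Unshelve. all: by end_near.
Qed.
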